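(* Let $p$ be an odd prime. (i) If $p\equiv1\pmod 4$, then $$\prod_{\substack{1\le i<j\le (p-1)/2\\ p\nmid i^2+j^2}}(i^2+j^2)\equiv(-1)^{\lfloor (p-5)/8\rfloor}\pmod p.$$ (ii) Let $a,b,c\in\mathbb Z$ with $ac(a+b+c)\not\equiv0\pmod p$, and set $\Delta=b^2-4ac$. Then $$\prod_{\substack{1\le i<j\le p-1\\ p\nmid ai^2+bij+cj^2}}(ai^2+bij+cj^2)\equiv\begin{cases}\left(\frac{a(a+b+c)}p\right)\pmod p&\text{if } p\mid\Delta,\\[2pt] -\left(\frac{ac(a+b+c)\Delta}p\right)\pmod p&\text{if } p\nmid\Delta.\end{cases}$$ If moreover $a+c=0$, then $$\prod_{\substack{1\le i,j\le (p-1)/2\\ p\nmid ai^2+bij+cj^2}}(ai^2+bij+cj^2)\equiv\begin{cases}\pm\frac{p-1}2!\pmod p&\text{if } \left(\frac{\Delta}p\right)=-1\text{ or }\left(p\mid\Delta\text{ and }\left(\frac{2b}p\right)=1\right),\\[2pt] \pm1\pmod p&\text{if } \left(\frac{\Delta}p\right)=1\text{ or }\left(p\mid\Delta\text{ and }\left(\frac{2b}p\right)=-1\right)\end{cases}$$ (here the congruence holds for one of the two choices of the sign $\pm$). (iii) Let $a,b,c\in\mathbb Z$ with $p\nmid ac$ and $p\mid a+b+c$. Then $$\prod_{\substack{1\le i<j\le p-1\\ p\nmid ai^2+bij+cj^2}}(ai^2+bij+cj^2)\equiv\begin{cases}(-1)^{N_p(a/c)}\left(\frac{2c(a-c)}p\right)\pmod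 p&\text{if } p\nmid a-c,\\[2pt](-1)^{(p+1)/2}\left(\frac ap\right)\pmod p&\text{if } p\mid a-c.\end{cases}$$ (iv) Let $a,b,c\in\mathbb Z$ with $p\mid ac$. Then $$\prod_{\substack{1\le i<j\le p-1\\ p\nmid ai^2+bij+cj^2}}(ai^2+bij+cj^2)\equiv\begin{cases}-\left(\frac bp\right)\pmod p&\text{if } p\mid a,\ p\nmid b\text{ and } p\mid c,\\ -\left(\frac cp\right)\pmod p&\text{if } p\mid a,\ p\nmid bc\text{ and } p\mid b+c,\\ (-1)^{N_p(-c/b)}\left(\frac2p\right)\pmod p&\text{if } p\mid a\text{ and } p\nmid bc(b+c),\\ (-1)^{(p+1)/2}\left(\frac cp\right)\pmod p&\text{if } p\mid a,\ p\mid b\text{ and } p\nmid c,\\ (-1)^{(p+1)/2}\left(\frac ap\right)\pmod p&\text{if } p\nmid a,\ p\mid b\text{ and } p\mid c,\\ (-1)^{(p+1)/2}\left(\frac bp\right)\pmod p&\text{if } p\nmid ab,\ p\mid a+b\text{ and } p\mid c,\\ (-1)^{N_p(-a/b)}\left(\frac2p\right)\pmod p&\text{if } p\nmid ab(a+b)\text{ and } p\mid c.\end{cases}$$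
   Context: $(\frac{\cdot}{p})$ is the Legendre symbol (with value $0$ on multiples of $p$), and empty products equal $1$. For a $p$-adic integer $y$ (in particular a rational number with denominator prime to $p$), $\{y\}_p$ denotes the unique $r\in\{0,\ldots,p-1\}$ with $y\equiv r\pmod p$. For a $p$-adic integer $x$, $$N_p(x):=\left|\{1\le k\le (p-1)/2:\ \{kx\}_p>k\}\right|.$$ *)

(* Defs.v *)
From mathcomp Require Import all_boot all_order all_algebra.

Set Implicit Arguments.
Unset Strict Implicit.
Unset Printing Implicit Defensive.

Import Order.TTheory GRing.Theory Num.Theory.

Local Open Scope ring_scope.

Definition legendre (p : nat) (a : int) : int :=
  if (p%:Z %| a)%Z then 0
  else if [exists x : 'I_p, (x%:Z ^+ 2 == a %[mod p%:Z])%Z] then 1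
  else -1.

(* The residue {y}_p of a p-integral rational y (a rational p-adic integer).
   Since numq is taken in lowest terms, p %| numq (y - r) holds exactly when
   y - r lies in p Z_(p), i.e. y = r mod p.  When p %| denq y no r qualifies
   and the value is the junk p. *)
Definition residue (p : nat) (y : rat) : nat :=
  find (fun r : nat => (p%:Z %| numq (y - r%:R))%Z) (iota 0 p).

Definition N (p : nat) (x : rat) : nat :=
  count (fun k : nat => (k < residue p (k%:R * x))%N)
        (index_iota 1 (p.-1./2).+1).

Definition qform (a b c : int) (i j : nat) : int :=
  a * i%:Z ^+ 2 + b * i%:Z * j%:Z + c * j%:Z ^+ 2.

(* Product of the values f i j prime to p, over 1 <= i < j <= n. *)
Definition prod_lt (p n : nat) (f : nat -> nat -> int) : int :=
  \prod_(1 <= i < n.+1)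
    \prod_(1 <= j < n.+1 | (i < j)%N && ~~ (p%:Z %| f i j)%Z) f i j.

(* Product of the values f i j prime to p, over 1 <= i, j <= n. *)
Definition prod_sq (p n : nat) (f : nat -> nat -> int) : int :=
  \prod_(1 <= i < n.+1)
    \prod_(1 <= j < n.+1 | ~~ (p%:Z %| f i j)%Z) f i j.

(* Main.v *)
Require Import Defs.
From mathcomp Require Import all_boot all_order all_algebra.
From mathcomp Require Import cyclic finfield zify ring.
Import Order.TTheory GRing.Theory Num.Theory.
Local Open Scope ring_scope.

(** Write h = (p-1)/2, chi(v) = v^h for the quadratic character with values in
F_p, and eps = (-1)^(h+1) = (h!)^2 (Wilson).

Each pair of residues 0 < i < j is (t j, j) with t = i/j different from 0 and 1,
and a i^2 + b i j + c j^2 = j^2 Q(t), with Q(t) = a t^2 + b t + c.  The form is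
even, and negation reverses the order of representatives, so for each t exactly
one of j, -j satisfies i < j; one may as well let j run over 1, ..., h.  The
product over j is then (h!)^2 Q(t)^h = eps chi(Q(t)), and the product over
i < j becomes that of the weights wt(Q(t)), t <> 0, 1, where wt(v) = eps chi(v)
and wt(0) = 1 ([prod_lt_ratio]).

The product of wt(Q(t)) over all t is easy when a <> 0: completing the square
turns it into the product of wt(a (s^2 - Delta)), where s and -s cancel because
weights are signs, and only s = 0 survives: wt(-a Delta) ([prod_wt_quad]).
Dividing by the weights at t = 0 and t = 1 gives
wt(-a Delta) wt(c) wt(a+b+c).  With the symmetry t -> 1/t exchanging a and c, and
the linear case a = c = 0, this evaluates the product over i < j for every
form.  The counting function N enters only through
(-1)^N(x) = chi(2 x (1-x)), which is Gauss's lemma in its parity form: for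
x <> 0 the sum of the residues of kx, 1 <= k <= h, has the parity recorded by
chi(2x); add those for x and 1 - x and note that
{kx} + {k(1-x)} is k, or k + p exactly when {kx} > k ([gauss_less]).

For the product S over 1 <= i, j <= h with c = -a, the form changes sign under
(x,y) -> (y,-x).  Hence the product over 1 <= x <= h and all y <> 0 is
(-1)^M S^2, with M the number of nonzero values, and it is also a product of
weights of a quadratic; counting its roots gives M.  This determines S^2, which
is all one needs for S up to sign.

For the sum of squares, p = 4n+1, fix a primitive root g.  The symmetry
(i,j) -> (j,i) of i^2 + j^2 allows the condition i < j to be replaced by the
condition that j/i is, up to sign, some g^m with 0 < m < n: inversion maps this
arc of exponents to its complement, up to the ratios with j^2 = i^2 or
j^2 = -i^2, which do not contribute.  The product becomes that
of wt(1 + g^(2m)), 0 < m < n, and chi of the product of the 1 + g^(2m) follows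
from two relations between that product and the product of the 1 - g^(2m),
together with n = -1/4 = (g^n/2)^2 in F_p ([prod_arc_chi]). *)

(** * Exchanging half systems *)

(** The choice of representatives of the pairs {x, tau x} does not affect the
product of a tau-invariant function: where P and Q disagree, tau maps one
choice to the other.  Points with F x = 1 are exempt, so that P and Q may fail
to be half systems there (in particular at fixed points of tau). *)
Lemma half_system (R : comNzRingType) (I : finType) (tau : I -> I) (F : I -> R)
    (P Q : pred I) :
  involutive tau -> (forall x, F (tau x) = F x) ->
  (forall x, F x != 1 -> P (tau x) = ~~ P x) ->
  (forall x, F x != 1 -> Q (tau x) = ~~ Q x) ->
  \prod_(x | P x) F x = \prod_(x | Q x) F x.
Proof.
move=> tauK Ftau Pflip Qflip.
rewrite (bigID Q) [RHS](bigID P) /=; congr (_ * _).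
  by apply: eq_bigl => x; rewrite andbC.
rewrite (reindex_inj (inv_inj tauK)) big_mkcond [RHS]big_mkcond /=.
apply: eq_bigr => x _; rewrite Ftau.
have [->|Fx] := eqVneq (F x) 1; first by rewrite !if_same.
by rewrite Pflip // Qflip // negbK andbC.
Qed.

(** The target ring R has to be kept independent of p: the carrier of 'F_p is
only propositionally an ordinal of size p. *)
Lemma prod_nat_Fp (R : comNzRingType) (p : nat) (p_prime : prime p)
    (G : nat -> R) :
  \prod_(0 <= i < p) G i = \prod_(x : 'F_p) G x.
Proof. by rewrite -{1}(Fp_cast p_prime) big_mkord. Qed.

(** * The field F_p and its lower half *)

Section PrimeField.
Set Implicit Arguments.
Unset Strict Implicit.

Variables (p : nat) (p_prime : prime p) (p_odd : odd p).

Let F := 'F_p.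
Let h := p.-1./2.
Let eps : F := (-1) ^+ h.+1.
Definition lower : pred F := fun x => (0 < x <= p.-1./2)%N.
(** Replacing zeros by 1 turns a product of nonzero values into a full one. *)
Definition skip0 (v : F) : F := if v == 0 then 1 else v.
(** The product of v x^2 over the lower half x = 1, ..., h, with zeros skipped;
see [prod_skip0_sqM]. *)
Definition wt (v : F) : F := if v == 0 then 1 else (-1) ^+ p.-1./2.+1 * v ^+ p.-1./2.

Lemma p_double : p = h.*2.+1.
Proof. by rewrite /h; move: (prime_gt1 p_prime) p_odd; lia. Qed.

Lemma p_gt2 : (2 < p)%N.
Proof. exact: odd_prime_gt2. Qed.

Lemma h_gt0 : (0 < h)%N.
Proof. by move: p_gt2; rewrite {1}p_double; lia. Qed.

Lemma val_lt (x : F) : (x < p)%N.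
Proof. by have := ltn_ord x; rewrite [X in (_ < X)%N -> _]Fp_cast. Qed.

Lemma val_gt0 (x : F) : (0 < x)%N = (x != 0).
Proof. by rewrite lt0n. Qed.

Lemma natr_val (x : F) : (x : nat)%:R = x :> F.
Proof. exact: natr_Zp. Qed.

Lemma val_natF n : (n < p)%N -> (n%:R : F) = n :> nat.
Proof. by move=> n_p; rewrite val_Fp_nat // modn_small. Qed.

Lemma val_opp (x : F) : x != 0 -> (- x : F) = (p - x)%N :> nat.
Proof.
move=> x0; have xp := val_lt x.
rewrite -{1}[x]natr_val -[LHS]val_natF; last exact: val_lt.
have x0' : (0 < x)%N by rewrite lt0n.
have {1}-> : - (x : nat)%:R = (p - x)%:R :> F.
  by rewrite natrB ?pchar_Fp_0 ?sub0r // ltnW.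
by rewrite natr_val val_natF //; lia.
Qed.

Lemma lower_opp (x : F) : x != 0 -> lower (- x) = ~~ lower x.
Proof.
move=> x0; rewrite /lower val_opp //.
have := val_lt x; have : (0 < x)%N by rewrite lt0n.
by move: p_double; rewrite -/h; lia.
Qed.

Lemma lower0 : lower 0 = false.
Proof. by []. Qed.

Lemma lower_neq0 (x : F) : lower x -> x != 0.
Proof. by apply: contraL => /eqP->. Qed.

Lemma two_neq0 : 2%:R != 0 :> F.
Proof.
apply/eqP => /(congr1 (@nat_of_ord _)); rewrite val_natF //.
exact: p_gt2.
Qed.

Lemma opp_neq (x : F) : x != 0 -> - x != x.
Proof.
move=> x0; rewrite eq_sym -subr_eq0 opprK -mulr2n -mulr_natr mulf_eq0.
by rewrite (negbTE x0) (negbTE two_neq0).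
Qed.

Lemma prod_nat_val (R : comNzRingType) n (G : nat -> R) : (n < p)%N ->
  \prod_(1 <= i < n.+1) G i = \prod_(x : F | (0 < x <= n)%N) G x.
Proof.
move=> n_p; rewrite (big_nat_widen _ _ _ _ _ n_p) (big_nat_widenl _ 0) //.
rewrite big_mkcond prod_nat_Fp // -big_mkcond.
by apply: eq_bigl => x; rewrite andbC.
Qed.

Lemma h_ltp : (h < p)%N.
Proof. by move: p_double; lia. Qed.

Lemma val_le_pred (x : F) : (0 < x <= p.-1)%N = (x != 0).
Proof. by rewrite -val_gt0; move: (val_lt x); lia. Qed.

Lemma prod_nat_lower (R : comNzRingType) (G : nat -> R) :
  \prod_(1 <= i < h.+1) G i = \prod_(x | lower x) G x.
Proof. exact/prod_nat_val/h_ltp. Qed.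

Lemma prod_nat_neq0 (R : comNzRingType) (G : nat -> R) :
  \prod_(1 <= i < p.-1.+1) G i = \prod_(x : F | x != 0) G x.
Proof.
rewrite prod_nat_val; last by move: (prime_gt1 p_prime); lia.
by apply: eq_bigl => x; rewrite val_le_pred.
Qed.

Lemma big_neq0_lower (T : Type) (idx : T) (op : Monoid.com_law idx) (G : F -> T) :
  \big[op/idx]_(x | x != 0) G x = \big[op/idx]_(x | lower x) op (G x) (G (- x)).
Proof.
rewrite (bigID lower) big_split /=; congr (op _ _).
  by apply: eq_bigl => x; case: (boolP (lower x)) => [/lower_neq0->|]; rewrite ?andbF.
rewrite [LHS](reindex_inj oppr_inj); apply: eq_bigl => x.
rewrite oppr_eq0; have [->|x0] := eqVneq x 0; first by rewrite lower0.
by rewrite lower_opp // negbK.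
Qed.

Lemma card_lower : #|lower| = h.
Proof.
have /eqP := prod_nat_lower (fun _ => 2%:R : int).
rewrite big_const_nat prodr_const subSS subn0.
have -> n : iter n ( *%R (2%:R : int)) 1 = 2%:R ^+ n.
  by elim: n => //= n ->; rewrite exprS.
by rewrite -!natrX eqr_nat eqn_exp2l // => /eqP.
Qed.

Lemma fact_lower : (h`!)%:R = \prod_(x | lower x) x :> F.
Proof.
rewrite fact_prod natr_prod prod_nat_lower.
by apply: eq_bigr => x _; rewrite natr_val.
Qed.

Lemma wilsonF : \prod_(x : F | x != 0) x = -1.
Proof.
have -> : \prod_(x : F | x != 0) x = (p.-1`!)%:R.
  rewrite fact_prod natr_prod prod_nat_neq0.
  by apply: eq_bigr => x _; rewrite natr_val.
apply/eqP; rewrite -subr_eq0 opprK natr1 -(dvdn_pcharf (pchar_Fp p_prime)).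
by rewrite -Wilson // prime_gt1.
Qed.

(** Wilson's product with x and -x paired. *)
Lemma prod_lower_sq : \prod_(x | lower x) x ^+ 2 = eps.
Proof.
have := wilsonF; rewrite big_neq0_lower /=.
under eq_bigr => x _ do rewrite mulrN -expr2.
rewrite prodrN card_lower => /(congr1 ( *%R ((-1) ^+ h))).
by rewrite mulrA -expr2 sqrr_sign mul1r mulrN1 => ->; rewrite /eps exprS mulN1r.
Qed.

Lemma fact_sq : (h`!)%:R ^+ 2 = eps.
Proof. by rewrite fact_lower -prodrXl prod_lower_sq. Qed.

Lemma eps_sq : eps ^+ 2 = 1.
Proof. exact: sqrr_sign. Qed.

Lemma expf_h2 (x : F) : x != 0 -> x ^+ h.*2 = 1.
Proof.
move=> x0; apply: (mulfI x0); rewrite -exprS -p_double mulr1.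
by have := expf_card x; rewrite card_Fp.
Qed.

Lemma chi_sq (x : F) : x != 0 -> (x ^+ h) ^+ 2 = 1.
Proof. by move=> x0; rewrite -exprM muln2 expf_h2. Qed.

Lemma chi_of_sq (x : F) : x != 0 -> (x ^+ 2) ^+ h = 1.
Proof. by move=> x0; rewrite -exprM mul2n expf_h2. Qed.

Lemma prod_skip0_sqM (v : F) : \prod_(x | lower x) skip0 (x ^+ 2 * v) = wt v.
Proof.
rewrite /wt /skip0; have [->|v0] := eqVneq v 0.
  by rewrite big1 // => x _; rewrite mulr0 eqxx.
rewrite -/h -/eps -prod_lower_sq -card_lower -prodr_const -big_split /=.
by apply: eq_bigr => x /lower_neq0 x0; rewrite mulf_eq0 expf_eq0 (negbTE x0) (negbTE v0).
Qed.

Lemma wt0 : wt 0 = 1. Proof. by rewrite /wt eqxx. Qed.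

Lemma wtE v : v != 0 -> wt v = eps * v ^+ h.
Proof. by rewrite /wt => /negbTE->. Qed.

Lemma wt_sq v : wt v ^+ 2 = 1.
Proof.
rewrite /wt; case: eqVneq => [_|v0]; first by rewrite expr1n.
by rewrite exprMn eps_sq chi_sq ?mul1r.
Qed.

Lemma wt_sqM u v : u != 0 -> wt (u ^+ 2 * v) = wt v.
Proof.
move=> u0; rewrite /wt mulf_eq0 expf_eq0 /= (negbTE u0) /=.
by case: eqP => // _; rewrite exprMn chi_of_sq ?mul1r.
Qed.

Lemma wt_neq0 v : wt v != 0.
Proof. by rewrite -sqrf_eq0 wt_sq oner_eq0. Qed.

(** * From pairs to ratios *)

Definition quad (a b c t : F) := a * t ^+ 2 + b * t + c.
Definition form (a b c x y : F) := a * x ^+ 2 + b * x * y + c * y ^+ 2.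

(** With x = t y, the pair (x, y) contributes y^2 quad(t).  Among (x, y) and
(-x, -y) the condition x < y selects one and the condition that y is in the
lower half selects one as well; the form does not distinguish them. *)
Lemma prod_lt_ratio a b c :
  \prod_(x : F | x != 0) \prod_(y : F | (y != 0) && (x < y)%N) skip0 (form a b c x y)
  = \prod_(t | (t != 0) && (t != 1)) wt (quad a b c t).
Proof.
pose G (z : F * F) := if [&& z.1 != 0, z.2 != 0 & z.1 != z.2]
  then skip0 (form a b c z.1 z.2) else 1.
transitivity (\prod_(z : F * F | (z.1 < z.2)%N) G z).
  rewrite pair_big_dep big_mkcond [RHS]big_mkcond /=; apply: eq_bigr => -[x y] _ /=.
  rewrite /G /=; case: (x == 0); case: (y == 0) => //=; rewrite ?if_same //.
  by case: ltnP => //; case: eqP => // ->; rewrite ltnn.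
rewrite (@half_system _ _ (fun z : F * F => (- z.1, - z.2)) _ _
  (fun z : F * F => lower z.2)).
- rewrite (eq_bigl (fun z : F * F => true && lower z.2)) //.
  rewrite -(pair_big predT lower (fun x y => G (x, y))) /= exchange_big /=.
  transitivity (\prod_(y | lower y) \prod_(t | (t != 0) && (t != 1))
    skip0 (y ^+ 2 * quad a b c t)).
    apply: eq_bigr => y /lower_neq0 y0.
    rewrite (reindex_inj (mulfI y0)) [RHS]big_mkcond /=; apply: eq_bigr => t _.
    rewrite /G /=.
    have -> : (y * t == y) = (t == 1) by rewrite -{2}[y]mulr1 (inj_eq (mulfI y0)).
    rewrite mulf_eq0 (negbTE y0) /=.
    by case: ifP => // _; congr skip0; rewrite /form /quad; ring.
  by rewrite exchange_big; apply: eq_bigr => t _; rewrite prod_skip0_sqM.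
- by case=> x y /=; rewrite !opprK.
- case=> x y; rewrite /G /= !oppr_eq0 eqr_opp.
  by case: ifP => // _; congr skip0; rewrite /form; ring.
- case=> x y Gxy; have /and3P[x0 y0 xy] : [&& x != 0, y != 0 & x != y].
    by move: Gxy; rewrite /G /=; case: ifP; rewrite ?eqxx.
  change ((- x < - y)%N = ~~ (x < y)%N).
  rewrite !val_opp //.
  have {xy}: (x : nat) <> y by move=> /val_inj /eqP; rewrite (negbTE xy).
  by move: (val_lt x) (val_lt y); lia.
- case=> x y Gxy; have /and3P[x0 y0 xy] : [&& x != 0, y != 0 & x != y].
    by move: Gxy; rewrite /G /=; case: ifP; rewrite ?eqxx.
  exact: lower_opp.
Qed.

Lemma quad_complete_square a b c s : a != 0 ->
  quad a b c ((s - b) / (2%:R * a))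
  = (2%:R * a)^-1 ^+ 2 * (a * (s ^+ 2 - (b ^+ 2 - 4%:R * a * c))).
Proof. by move=> a0; rewrite /quad; field; rewrite a0 two_neq0. Qed.

(** After completing the square, s and -s have the same weight, a sign, so that
only s = 0 contributes. *)
Lemma prod_wt_quad a b c : a != 0 ->
  \prod_t wt (quad a b c t) = wt (- (a * (b ^+ 2 - 4%:R * a * c))).
Proof.
move=> a0; set D := b ^+ 2 - _.
have ta0 : 2%:R * a != 0 by rewrite mulf_neq0 ?two_neq0.
pose sub (s : F) := (s - b) / (2%:R * a).
have sub_inj : injective sub by move=> s s' /(divIf ta0)/addIr.
rewrite (reindex_inj sub_inj) /=.
transitivity (\prod_s wt (a * (s ^+ 2 - D))).
  apply: eq_bigr => s _.
  by rewrite quad_complete_square // wt_sqM ?invr_eq0.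
rewrite (bigD1 0) //= expr0n /= sub0r mulrN big_neq0_lower big1 ?mulr1 // => s _ /=.
by rewrite sqrrN -expr2 wt_sq.
Qed.

(** Weights are signs, so the factors at t = 0 and t = 1 are removed by
multiplying by them again. *)
Lemma prod_wt_quad01 a b c : a != 0 ->
  \prod_(t | (t != 0) && (t != 1)) wt (quad a b c t)
  = wt (- (a * (b ^+ 2 - 4%:R * a * c))) * wt c * wt (a + b + c).
Proof.
move=> a0; rewrite -prod_wt_quad // [X in X * _ * _](bigD1 0) //=.
rewrite [X in _ * X * _ * _](bigD1 1) ?oner_neq0 //=.
have -> : quad a b c 0 = c by rewrite /quad; ring.
have -> : quad a b c 1 = a + b + c by rewrite /quad; ring.
have E (u v z : F) : u ^+ 2 = 1 -> v ^+ 2 = 1 -> z = u * (v * z) * u * v.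
  by move=> u1 v1; transitivity (u ^+ 2 * v ^+ 2 * z); [rewrite u1 v1 !mul1r | ring].
by apply: E; rewrite wt_sq.
Qed.

(** The reversed quadratic is t^2 quad(1/t), and weights ignore squares. *)
Lemma prod_wt_quad_sym a b c :
  \prod_(t | (t != 0) && (t != 1)) wt (quad a b c t)
  = \prod_(t | (t != 0) && (t != 1)) wt (quad c b a t).
Proof.
rewrite (reindex_inj (can_inj (@invrK _))) /=.
apply: eq_big => [t|t /andP[t0 _]]; first by rewrite invr_eq0 invr_eq1.
rewrite invr_eq0 in t0.
rewrite -[RHS](@wt_sqM t^-1) ?invr_eq0 //; congr wt; rewrite /quad; field; exact: t0.
Qed.

(** Over t <> 0 each pair t, -t contributes (-1)^h, so that the whole product is
(-1)^(h^2) = (-1)^h; the factor at t = 1 is then removed. *)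
Lemma prod_wt_lin b : b != 0 ->
  \prod_(t | (t != 0) && (t != 1)) wt (quad 0 b 0 t) = - b ^+ h.
Proof.
move=> b0.
have all_t : \prod_(t | t != 0) wt (quad 0 b 0 t) = (-1) ^+ h.
  rewrite big_neq0_lower /= (eq_bigr (fun=> (-1) ^+ h)).
    by rewrite prodr_const card_lower -exprM -signr_odd oddM andbb signr_odd.
  move=> t /lower_neq0 t0.
  have -> : quad 0 b 0 (- t) = -1 * quad 0 b 0 t by rewrite /quad; ring.
  have qt0 : quad 0 b 0 t != 0 by rewrite /quad mul0r add0r addr0 mulf_neq0.
  rewrite !wtE ?mulf_neq0 ?oppr_eq0 ?oner_eq0 // exprMn.
  rewrite [LHS](_ : _ = eps ^+ 2 * (quad 0 b 0 t ^+ h) ^+ 2 * (-1) ^+ h); last by ring.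
  by rewrite eps_sq chi_sq // !mul1r.
move: all_t; rewrite (bigD1 1) ?oner_neq0 //=.
have -> : quad 0 b 0 1 = b by rewrite /quad; ring.
move=> e; apply: (mulfI (wt_neq0 b)); rewrite e wtE // /eps mulrN mulrAC -!mulrA -expr2.
by rewrite chi_sq // mulr1 exprS mulN1r opprK.
Qed.

(** * Primitive roots and the Legendre symbol *)

Lemma sgn_chi (x : F) : x != 0 -> x ^+ h = 1 \/ x ^+ h = -1.
Proof. by move=> x0; move/eqP: (chi_sq x0); rewrite sqrf_eq1 => /orP[]/eqP; [left | right]. Qed.

Lemma prim_root_ex : exists g : F, (h.*2).-primitive_root g.
Proof.
have : has (h.*2).-primitive_root (enum (predC1 (0 : F))).
  apply: has_prim_root; rewrite ?double_gt0 ?h_gt0 ?enum_uniq //.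
    by apply/allP => x; rewrite mem_enum unity_rootE => x0; rewrite expf_h2.
  by rewrite -cardE cardC1 card_Fp //; move: p_double; lia.
by case/hasP=> g _ ?; exists g.
Qed.

(** Euler's criterion: g^m has trivial character only if m is even. *)
Lemma euler (x : F) : x != 0 -> x ^+ h = 1 -> exists s, s ^+ 2 = x.
Proof.
move=> x0; have [g gP] := prim_root_ex.
case: (prim_rootP gP (expf_h2 x0)) => -[m _] /= ->.
rewrite -exprM => /eqP; rewrite -(prim_order_dvd gP) -mul2n dvdn_pmul2r ?h_gt0 //.
by move=> /dvdnP[k ->]; exists (g ^+ k); rewrite exprM.
Qed.

Lemma dvdz_Fp (m : int) : (p %| m)%Z = (m%:~R == 0 :> F).
Proof. exact/dvdz_pcharf/pchar_Fp. Qed.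

Lemma eqmodz_Fp (m n : int) : m%:~R = n%:~R :> F -> (m = n %[mod p])%Z.
Proof. by move=> e; apply/eqP; rewrite eqz_mod_dvd dvdz_Fp rmorphB /= e subrr. Qed.

Lemma legendreF (m : int) : (legendre p m)%:~R = (m%:~R : F) ^+ h.
Proof.
rewrite /legendre dvdz_Fp; case: (eqVneq (m%:~R : F)) => [->|m0].
  by rewrite expr0n gtn_eqF ?h_gt0.
case: existsP => [[x]|nsq].
  rewrite eqz_mod_dvd dvdz_Fp rmorphB /= subr_eq0 => /eqP e.
  rewrite -e rmorphXn /= chi_of_sq //.
  by apply: contra m0 => /eqP x0; rewrite -e rmorphXn /= x0 expr0n.
case: (sgn_chi m0) => // /(euler m0)[s sE]; case: nsq.
exists (Ordinal (val_lt s)); rewrite eqz_mod_dvd dvdz_Fp rmorphB rmorphXn /= subr_eq0.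
by rewrite -sE -[in X in _ == X](natr_val s).
Qed.

(** * Gauss's lemma and the counting function *)

Definition sgn (y : F) : F := (-1) ^+ (y : nat).

Lemma sgn_opp y : y != 0 -> sgn (- y) = - sgn y.
Proof.
move=> y0; rewrite /sgn val_opp // -signr_odd oddB ?p_odd; last exact/ltnW/val_lt.
by rewrite signr_addb expr1 mulN1r signr_odd.
Qed.

Lemma prod_lower_neq0 : \prod_(k | lower k) k != 0 :> F.
Proof. by apply/prodf_neq0 => k /lower_neq0. Qed.

(** Since p is odd, y -> (-1)^y y (y read in 0, ..., p-1) is an even function, so
its product over x, 2x, ..., hx is the same as over 1, ..., h.  This replaces the
least absolute residues of Gauss's proof by parities. *)
Lemma gauss_parity x : x != 0 ->
  \prod_(k | lower k) sgn (k * x) = (\prod_(k | lower k) sgn k) * x ^+ h.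
Proof.
move=> x0.
(* e is 1 at 0, so that 0 is exempt in half_system *)
pose e y := sgn y * skip0 y.
have eN y : e (- y) = e y.
  have [->|y0] := eqVneq y 0; first by rewrite oppr0.
  by rewrite /e sgn_opp // /skip0 oppr_eq0 (negbTE y0) mulrNN.
have key : \prod_(k | lower k) e (k * x) = \prod_(k | lower k) e k.
  rewrite [RHS](reindex_inj (mulIf x0)).
  apply: (@half_system _ _ -%R); first exact: opprK.
  - by move=> k; rewrite mulNr eN.
  - move=> k ek; apply: lower_opp; apply: contra ek => /eqP->.
    by rewrite mul0r /e /skip0 /sgn eqxx mulr1.
  - move=> k ek; rewrite mulNr lower_opp // mulf_neq0 //; apply: contra ek => /eqP->.
    by rewrite mul0r /e /skip0 /sgn eqxx mulr1.
move: key; rewrite !big_split /=.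
have -> : \prod_(k | lower k) skip0 (k * x) = (\prod_(k | lower k) k) * x ^+ h.
  rewrite -card_lower -prodr_const -big_split /=; apply: eq_bigr => k /lower_neq0 k0.
  by rewrite /skip0 mulf_eq0 (negbTE x0) (negbTE k0).
have -> : \prod_(k | lower k) skip0 k = \prod_(k | lower k) k.
  by apply: eq_bigr => k /lower_neq0 k0; rewrite /skip0 (negbTE k0).
move=> key; apply: (mulIf prod_lower_neq0); rewrite mulrAC -key.
rewrite [RHS](_ : _ = \prod_(k | lower k) sgn (k * x) * \prod_(k | lower k) k
  * (x ^+ h) ^+ 2); last by ring.
by rewrite chi_sq // mulr1.
Qed.

(** For x = 2 the residues 2k, k <= h, are all even. *)
Lemma prod_sgn_lower : \prod_(k | lower k) sgn k = 2%:R ^+ h.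
Proof.
have := gauss_parity two_neq0; rewrite big1 => [e|k kh].
  by rewrite -[RHS]mul1r [X in _ = X * _]e -mulrA -expr2 (chi_sq two_neq0) mulr1.
rewrite /sgn.
have -> : (k * 2%:R : F) = (k * 2)%N :> nat.
  rewrite -{1}(natr_val k) -natrM val_natF //.
  by move: kh; rewrite /lower -/h; move: p_double; lia.
by rewrite exprM sqrr_sign.
Qed.

Lemma sgn_mul_sub (k y : F) : sgn y * sgn (k - y) = sgn k * (-1) ^+ (k < y)%N.
Proof.
have kp := val_lt k; have yp := val_lt y.
have vE : (k - y : F) = (if (k < y)%N then p + k - y else k - y)%N :> nat.
  rewrite -[RHS]val_natF; last by case: (ltnP k y); lia.
  congr nat_of_ord; case: (ltnP k y) => ky.
    by rewrite natrB ?natrD ?pchar_Fp_0 ?add0r ?natr_val //; lia.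
  by rewrite natrB ?natr_val.
rewrite /sgn vE -!exprD -signr_odd -[RHS]signr_odd; congr (_ ^+ nat_of_bool _).
by case: (ltnP k y) => ky /=; lia.
Qed.

(** The parities for x and 1 - x are added: the residues of k x and k (1 - x) sum
to k, or to k + p when that of k x exceeds k. *)
Lemma gauss_less (x : F) : x != 0 -> x != 1 ->
  \prod_(k | lower k) (-1) ^+ (k < (k * x)%R)%N = (2%:R * x * (1 - x)) ^+ h.
Proof.
move=> x0 x1; have x1' : 1 - x != 0 by rewrite subr_eq0 eq_sym.
have : \prod_(k | lower k) (sgn (k * x) * sgn (k * (1 - x)))
     = \prod_(k | lower k) (sgn k * (-1) ^+ (k < (k * x)%R)%N).
  by apply: eq_bigr => k _; rewrite mulrBr mulr1 sgn_mul_sub.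
rewrite !big_split /= !gauss_parity // prod_sgn_lower => e.
have k0 : 2%:R ^+ h != 0 :> F by rewrite expf_neq0 ?two_neq0.
by apply: (mulfI k0); rewrite -e !exprMn; ring.
Qed.

(** * The square product with c = -a *)

(** For c = -a the form is negated by the quarter turn (x, y) -> (y, -x), which
carries the square of the lower half to the part of the strip x in the lower
half, y <> 0, that lies outside it.  The strip is then fibred by t = y/x.  It
is stated for any commutative monoid because both the product of values and the
number of nonzero values are needed. *)
Lemma big_square_split (T : Type) (idx : T) (op : Monoid.com_law idx)
    (G : F -> T) (a b : F) :
  op (\big[op/idx]_(x | lower x) \big[op/idx]_(y | lower y) G (form a b (- a) x y))
     (\big[op/idx]_(x | lower x) \big[op/idx]_(y | lower y) G (- form a b (- a) x y))
  = \big[op/idx]_(t | t != 0) \big[op/idx]_(x | lower x) G (x ^+ 2 * quad (- a) b a t).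
Proof.
rewrite [X in op _ X]exchange_big -big_split /= [RHS]exchange_big /=.
apply: eq_bigr => x /lower_neq0 x0.
rewrite -big_split /=.
transitivity (\big[op/idx]_(y | y != 0) G (form a b (- a) x y)).
  rewrite big_neq0_lower; apply: eq_bigr => y _; congr (op _ (G _)).
  by rewrite /form; ring.
rewrite (reindex_inj (mulfI x0)) /=; apply: eq_big => [t|t _].
  by rewrite mulf_eq0 (negbTE x0).
by congr G; rewrite /form /quad; ring.
Qed.

Lemma skip0_opp v : skip0 (- v) = (-1) ^+ (v != 0) * skip0 v.
Proof. by rewrite /skip0 oppr_eq0; case: eqP => //= _; rewrite ?mul1r ?mulN1r. Qed.

Lemma big_neq0_split (v : F -> F) :
  \prod_t v t = v 0 * \prod_(t | t != 0) v t.
Proof. exact: bigD1. Qed.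

Section Square.

Variables a b : F.
Hypothesis a0 : a != 0.
Let D := b ^+ 2 + 4%:R * a ^+ 2.
Let S := \prod_(x | lower x) \prod_(y | lower y) skip0 (form a b (- a) x y).
Let M := (\sum_(x | lower x) \sum_(y | lower y) (form a b (- a) x y != 0%R))%N.

Lemma square_rel : (-1) ^+ M * S ^+ 2 = wt (a * D) * wt a.
Proof.
have := big_square_split [the Monoid.com_law _ of *%R] skip0 a b; rewrite -/S /=.
have -> : \prod_(x | lower x) \prod_(y | lower y) skip0 (- form a b (- a) x y)
  = (-1) ^+ M * S.
  rewrite /M expr_sum -big_split /=; apply: eq_bigr => x _.
  by rewrite expr_sum -big_split /=; apply: eq_bigr => y _; rewrite skip0_opp.
rewrite mulrCA -expr2 => ->.
under eq_bigr => t _ do rewrite prod_skip0_sqM.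
have := @prod_wt_quad (- a) b a; rewrite oppr_eq0 => /(_ a0).
rewrite big_neq0_split.
have -> : quad (- a) b a 0 = a by rewrite /quad; ring.
have -> : - (- a * (b ^+ 2 - 4 * - a * a)) = a * D by rewrite /D; ring.
by move=> <-; rewrite mulrAC -expr2 wt_sq mul1r.
Qed.

(** Both sides count the nonzero values on the strip; #|[s | s^2 = D]| is the
number of ratios t at which the form vanishes. *)
Lemma square_count : (M + M = h * (h.*2 - #|[pred s : F | s ^+ 2 == D]|))%N.
Proof.
have := big_square_split [the Monoid.com_law _ of addn] (fun v => (v != 0) : nat) a b.
rewrite /=.
have -> : (\sum_(x | lower x) \sum_(y | lower y) (- form a b (- a) x y != 0%R) = M)%N.
  by apply: eq_bigr => x _; apply: eq_bigr => y _; rewrite oppr_eq0.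
rewrite -/M => ->.
have -> : (#|[pred s : F | s ^+ 2 == D]|
    = \sum_(t : F | t != 0%R) (quad (- a) b a t == 0%R))%N.
  have sub0 : quad (- a) b a 0 != 0 by rewrite /quad expr0n /= !mulr0 !add0r.
  rewrite -sum1_card big_mkcond /= [RHS]big_mkcond /=.
  have na0 : - a != 0 by rewrite oppr_eq0.
  have na20 : 2%:R * - a != 0 by rewrite mulf_neq0 ?two_neq0.
  rewrite [RHS](reindex_inj (_ : injective (fun s => (s - b) / (2%:R * - a)))); last first.
    by move=> s s' /(divIf na20)/addIr.
  apply: eq_bigr => s _.
  have e : (quad (- a) b a ((s - b) / (2%:R * - a)) == 0) = (s ^+ 2 == D).
    rewrite quad_complete_square // mulf_eq0 expf_eq0 /= invr_eq0 (negbTE na20) /=.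
    rewrite mulf_eq0 (negbTE na0) /= subr_eq0; congr (_ == _); rewrite /D; ring.
  rewrite inE /= -e; case: eqP => [z|]; last by rewrite if_same.
  by case: eqP z => // -> /eqP; rewrite (negbTE sub0).
have -> : (h.*2 = \sum_(t : F | t != 0%R) 1)%N.
  by rewrite sum1_card cardC1 card_Fp // p_double.
rewrite -sumnB; last by move=> t _; case: eqP.
rewrite big_distrr /=; apply: eq_bigr => t _.
rewrite -card_lower -sum_nat_const; apply: eq_bigr => x /lower_neq0 x0.
by rewrite mulf_eq0 expf_eq0 (negbTE x0) /=; case: eqP.
Qed.

Lemma chi0 : 0 ^+ h = 0 :> F.
Proof. by rewrite expr0n gtn_eqF ?h_gt0. Qed.

Lemma one_neqN1 : 1 != -1 :> F.
Proof. by rewrite -subr_eq0 opprK two_neq0. Qed.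

(** (1 + i)^2 = 2i. *)
Lemma chi_double_i (i : F) : i ^+ 2 = -1 -> (2%:R * i) ^+ h = 1.
Proof.
move=> i2; have -> : 2%:R * i = (1 + i) ^+ 2 by rewrite sqrrD i2 expr1n; ring.
apply: chi_of_sq; rewrite addrC -[1]opprK subr_eq0; apply/eqP => e.
by move: one_neqN1; rewrite -i2 e sqrrN expr1n eqxx.
Qed.

Lemma square_nonres : D ^+ h = -1 -> S ^+ 2 = eps.
Proof.
move=> Dh; have D0 : D != 0.
  by apply/eqP => D0; move/eqP: Dh; rewrite D0 chi0 eq_sym oppr_eq0 oner_eq0.
have R0 : #|[pred s : F | s ^+ 2 == D]| = 0%N.
  apply: eq_card0 => s; rewrite !inE; apply/negP => /eqP sD; move: Dh.
  rewrite -sD chi_of_sq; first by move/eqP; rewrite (negbTE one_neqN1).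
  by apply: contra D0 => /eqP s0; rewrite -sD s0 expr0n.
have M_eq : M = (h * h)%N by move: square_count; rewrite R0; lia.
have := square_rel; rewrite M_eq -signr_odd oddM andbb signr_odd.
rewrite !wtE ?mulf_neq0 // exprMn Dh => e.
rewrite -[LHS]mul1r -(sqrr_sign F h) expr2 -mulrA e.
rewrite [LHS](_ : _ = - (-1) ^+ h * (eps ^+ 2 * (a ^+ h) ^+ 2)); last by ring.
by rewrite eps_sq chi_sq // !mulr1 /eps exprS mulN1r.
Qed.

Lemma square_res : D != 0 -> D ^+ h = 1 -> S ^+ 2 = 1.
Proof.
move=> D0 Dh; have [s0 sD] := euler D0 Dh.
have s00 : s0 != 0 by apply: contra D0 => /eqP s0_; rewrite -sD s0_ expr0n.
have R2 : #|[pred s : F | s ^+ 2 == D]| = 2%N.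
  rewrite (eq_card (_ : _ =i pred2 s0 (- s0))) ?card2; last first.
    by move=> s; rewrite !inE -sD eqf_sqr.
  by rewrite eq_sym opp_neq.
have : odd M = false.
  have [k hk] : exists k, h = k.+1 by exists h.-1; rewrite prednK ?h_gt0.
  have -> : M = (k.+1 * k)%N by move: square_count; rewrite R2 hk; nia.
  by rewrite oddM /= andNb.
have := square_rel; rewrite -signr_odd => e M_even; move: e.
rewrite M_even mul1r !wtE ?mulf_neq0 // exprMn Dh => ->.
rewrite [LHS](_ : _ = eps ^+ 2 * (a ^+ h) ^+ 2); last by ring.
by rewrite eps_sq chi_sq // mulr1.
Qed.

(** Here i = b/(2a) is a square root of -1.  The count makes h even
with M and h/2 of the same parity, so (-1)^M = chi(i) = chi(2), and 2b = 4ai. *)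
Lemma square_zero : D = 0 -> eps = -1 /\ S ^+ 2 = - (2%:R * b) ^+ h.
Proof.
move=> D0; have R1 : #|[pred s : F | s ^+ 2 == D]| = 1%N.
  by rewrite D0 (eq_card (_ : _ =i pred1 0)) ?card1 // => s; rewrite !inE sqrf_eq0.
have [h_even M_odd] : odd h = false /\ odd M = odd h./2.
  have := square_count; rewrite R1 -[h]odd_double_half.
  case: (odd h) => /=; move: (h./2) => k; rewrite ?add0n => e; first by nia.
  have -> : M = (k * (4 * k - 1))%N by nia.
  split; first by lia.
  case: k {e} => // k; rewrite (_ : 4 * k.+1 - 1 = k.*2.*2 + 3)%N; last by lia.
  by rewrite oddM oddD !odd_double andbT doubleK.
have [n h2n] : exists n, h = n.*2 by exists h./2; lia.
have epsN : eps = -1 by rewrite /eps -signr_odd /= h_even.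
have hh : h./2 = n by rewrite h2n doubleK.
split=> //; pose i := b / (2%:R * a).
have i2 : i ^+ 2 = -1.
  have -> : i ^+ 2 = D / (2%:R * a) ^+ 2 - 1.
    by rewrite /i /D; field; rewrite a0 two_neq0.
  by rewrite D0 mul0r sub0r.
have ih : i ^+ h = (-1) ^+ n by rewrite h2n -mul2n exprM i2.
have -> : 2%:R * b = 2%:R ^+ 2 * a * i by rewrite /i; field; rewrite a0 two_neq0.
have := square_rel; rewrite D0 mulr0 wt0 mul1r wtE // epsN -signr_odd M_odd signr_odd hh.
rewrite [(_ * i) ^+ h]exprMn ih exprMn chi_of_sq ?two_neq0 // => e.
transitivity ((-1) ^+ n * ((-1) ^+ n * S ^+ 2)); last by rewrite e; ring.
by rewrite mulrA -expr2 sqrr_sign mul1r.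
Qed.

End Square.

(** * Sums of two squares *)

(** Evaluate (X^n - 1)/(X - 1) = 1 + X + ... + X^(n-1) at 1. *)
Lemma prim_root_prod n (z : F) : n.-primitive_root z ->
  \prod_(1 <= m < n) (1 - z ^+ m) = n%:R.
Proof.
move=> zP; have n_gt0 := prim_order_gt0 zP.
have := factor_Xn_sub_1 zP; rewrite big_ltn // expr0 subrX1 => /(mulfI _) e.
have {}e : \prod_(1 <= i < n) ('X - (z ^+ i)%:P) = \sum_(i < n) 'X^i :> {poly F}.
  by apply: e; rewrite polyXsubC_eq0.
move/(congr1 (fun r : {poly F} => r.[1])): e.
rewrite horner_prod horner_sum; under eq_bigr => m _ do rewrite hornerXsubC.
move=> ->; under eq_bigr => m _ do rewrite hornerXn expr1n.
by rewrite sumr_const card_ord.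
Qed.

(** Any half system E for inversion, stable under negation, can replace the order
relation: the pair (x, y) is then chosen when y/x is in E.  Writing y = x k,
evenness lets k, like x, run over the lower half.  The ratios k with k^2 = 1 do not
come from x <> y in the lower half, and those with k^2 = -1 give a zero value. *)
Lemma prod_lt_sum_sq (E : pred F) :
  E 1 = false -> (forall k, E (- k) = E k) ->
  (forall k, k != 0 -> k ^+ 2 != 1 -> k ^+ 2 != -1 -> E k^-1 = ~~ E k) ->
  \prod_(x | lower x) \prod_(y | lower y && (x < y)%N) skip0 (x ^+ 2 + y ^+ 2)
  = \prod_(k | lower k && E k) wt (1 + k ^+ 2).
Proof.
move=> E1 EN EV.
pose G (z : F * F) := if [&& lower z.1, lower z.2 & z.1 != z.2]
  then skip0 (z.1 ^+ 2 + z.2 ^+ 2) else 1.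
transitivity (\prod_(z : F * F | (z.1 < z.2)%N) G z).
  rewrite pair_big_dep big_mkcond [RHS]big_mkcond /=; apply: eq_bigr => -[x y] _ /=.
  rewrite /G /=; case: (lower x); case: (lower y) => //=; rewrite ?if_same //.
  by case: ltnP => //; case: eqP => // ->; rewrite ltnn.
rewrite (@half_system _ _ (fun z : F * F => (z.2, z.1)) _ _
  (fun z : F * F => E (z.2 / z.1))).
- pose G1 (x y : F) := if E (y / x) then skip0 (x ^+ 2 + y ^+ 2) else 1.
  transitivity (\prod_(x | lower x) \prod_(y | lower y) G1 x y).
    rewrite pair_big big_mkcond [RHS]big_mkcond /=; apply: eq_bigr => -[x y] _ /=.
    rewrite /G /G1 /=; case: (boolP (lower x)) => [/lower_neq0 x0|]; rewrite /= ?if_same //.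
    case: (lower y); rewrite /= ?if_same //.
    by case: (eqVneq x y) => [<-|//]; rewrite divff // E1.
  (* for fixed x, replace y in the lower half by y/x in the lower half *)
  transitivity (\prod_(x | lower x) \prod_(k | lower k) G1 x (x * k)).
    apply: eq_bigr => x /lower_neq0 x0.
    pose G2 y := if y == 0 then 1 else G1 x y.
    transitivity (\prod_(y | lower (x^-1 * y)) G2 y).
      transitivity (\prod_(y | lower y) G2 y).
        by apply: eq_bigr => y /lower_neq0 /negbTE y0; rewrite /G2 y0.
      apply: (@half_system _ _ -%R); first exact: opprK.
      + by move=> y; rewrite /G2 oppr_eq0 /G1 mulNr EN sqrrN.
      + by move=> y; rewrite /G2; case: (eqVneq y 0) => [_|y0 _]; rewrite ?eqxx // lower_opp.
      + move=> y; rewrite /G2; case: (eqVneq y 0) => [_|y0 _]; rewrite ?eqxx //.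
        by rewrite mulrN lower_opp // mulf_neq0 ?invr_eq0.
    rewrite (reindex_inj (mulfI x0)) /=; apply: eq_big => [k|k]; rewrite mulKf //.
    by move=> /lower_neq0 k0; rewrite /G2 mulf_eq0 (negbTE x0) (negbTE k0).
  rewrite exchange_big [RHS]big_mkcondr /=; apply: eq_bigr => k _.
  rewrite -prod_skip0_sqM; case: ifP => Ek; last first.
    by rewrite big1 // => x /lower_neq0 x0; rewrite /G1 mulrAC divff // mul1r Ek.
  apply: eq_bigr => x /lower_neq0 x0; rewrite /G1 mulrAC divff // mul1r Ek.
  by congr skip0; ring.
- by case.
- by case=> x y; rewrite /G /= addrC eq_sym; case: (lower x); case: (lower y).
- case=> x y; rewrite /G; case: ifP; rewrite ?eqxx // => /and3P[_ _ xy] _ /=.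
  have {}xy : (x : nat) <> y by move=> /val_inj /eqP; rewrite (negbTE xy).
  by case: (ltngtP x y) => // /xy.
- case=> x y; rewrite /G; case: ifP; rewrite ?eqxx //= => /and3P[hx hy xy].
  rewrite /skip0; case: (eqVneq (x ^+ 2 + y ^+ 2) 0) => [_|xy0 _]; rewrite ?eqxx //.
  have [x0 y0] := (lower_neq0 hx, lower_neq0 hy).
  rewrite -EV ?invf_div ?mulf_neq0 ?invr_eq0 // expr_div_n.
    rewrite -subr_eq0 -(divff (_ : x ^+ 2 != 0)) ?expf_neq0 // -mulrBl.
    rewrite mulf_neq0 ?invr_eq0 ?expf_neq0 // subr_eq0 eqf_sqr negb_or eq_sym xy /=.
    by apply/eqP => e; move: hy; rewrite e lower_opp // hx.
  rewrite -subr_eq0 opprK -(divff (_ : x ^+ 2 != 0)) ?expf_neq0 // -mulrDl.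
  by rewrite mulf_neq0 ?invr_eq0 ?expf_neq0 // addrC.
Qed.

Section SumOfSquares.
Variables (n : nat) (g : F).
Hypotheses (h2n : h = n.*2) (gP : (h.*2).-primitive_root g).

Lemma g_pow i j : (g ^+ i == g ^+ j) = (i == j %[mod 4 * n])%N.
Proof. by rewrite (eq_prim_root_expr gP) h2n -!mul2n mulnA. Qed.

Lemma n_gt0 : (0 < n)%N.
Proof. by move: h_gt0; rewrite h2n double_gt0. Qed.

Lemma g_half : g ^+ h = -1.
Proof.
have : (g ^+ h) ^+ 2 == 1 by rewrite -exprM muln2 prim_expr_order.
rewrite sqrf_eq1 => /orP[|/eqP//].
rewrite -(expr0 g) g_pow h2n => /eqP; rewrite mod0n modn_small; move: n_gt0; lia.
Qed.

(** The arc of exponents 0 < m < n; with its negative it is a half system for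
inversion on the exponents modulo 4n that n does not divide. *)
Definition arc : pred F := fun k => k \in [seq g ^+ m | m <- index_iota 1 n].

Lemma arc_pow m : arc (g ^+ m) = (0 < m %% (4 * n) < n)%N.
Proof.
have n0 := n_gt0.
apply/mapP/idP => [[j]|m_small].
  rewrite mem_index_iota => /andP[j0 jn] /eqP; rewrite g_pow => /eqP->.
  by rewrite modn_small; lia.
exists (m %% (4 * n))%N; first by rewrite mem_index_iota.
by apply/eqP; rewrite g_pow modn_mod.
Qed.

Lemma opp_pow m : - g ^+ m = g ^+ (m + 2 * n).
Proof. by rewrite exprD mul2n -h2n g_half mulrN1. Qed.

Lemma pow_of (k : F) : k != 0 -> exists2 m, (m < 4 * n)%N & k = g ^+ m.
Proof.
move=> k0; case: (prim_rootP gP (expf_h2 k0)) => -[m m_lt] /= ->; exists m => //.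
by move: m_lt; rewrite h2n; lia.
Qed.

Lemma arc_opp k : arc (- k) -> ~~ arc k.
Proof.
have [->|k0] := eqVneq k 0; first by rewrite oppr0 => /mapP[j _ /esym/eqP];
  rewrite expf_eq0 (prim_root_eq0 gP) andbC; move: h_gt0; case: (h).
have [m m_lt ->] := pow_of k0; rewrite opp_pow !arc_pow.
have := n_gt0 => n0; rewrite (modn_small m_lt).
have [lt|ge] := ltnP (m + 2 * n) (4 * n); first by rewrite modn_small //; lia.
by rewrite (_ : m + 2 * n = m - 2 * n + 4 * n)%N ?modnDr ?modn_small; lia.
Qed.

Lemma arc_inv k : k != 0 -> k ^+ 2 != 1 -> k ^+ 2 != -1 ->
  arc k^-1 || arc (- k^-1) = ~~ (arc k || arc (- k)).
Proof.
move=> k0; have [m m_lt ->] := pow_of k0; have n0 := n_gt0.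
have m2 : (m != 0)%N && (m != 2 * n)%N && (m != n)%N && (m != 3 * n)%N
  = (g ^+ m ^+ 2 != 1) && (g ^+ m ^+ 2 != -1).
  rewrite -g_half -(expr0 g) -exprM !g_pow h2n mod0n.
  rewrite (@modn_small n.*2); last by lia.
  have [lt|ge] := ltnP (m * 2) (4 * n); first by rewrite modn_small //; lia.
  by rewrite (_ : m * 2 = m * 2 - 4 * n + 4 * n)%N ?modnDr ?modn_small; lia.
move=> e1 e2; move: m2; rewrite e1 e2 /= => /andP[/andP[/andP[m1 m2] m3] m4].
have -> : (g ^+ m)^-1 = g ^+ (4 * n - m).
  apply: (mulfI (_ : g ^+ m != 0)).
    by rewrite expf_neq0 // (prim_root_eq0 gP); move: h_gt0; case: (h).
  rewrite mulfV; last by rewrite expf_neq0 // (prim_root_eq0 gP); move: h_gt0; case: (h).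
  rewrite -exprD subnKC; last by lia.
  by apply/esym/eqP; rewrite -(expr0 g) g_pow modnn mod0n.
rewrite !opp_pow !arc_pow (modn_small m_lt) (@modn_small (4 * n - m)); last by lia.
have [lt|ge] := ltnP m (2 * n).
  rewrite (@modn_small (m + 2 * n)); last by lia.
  by rewrite (_ : 4 * n - m + 2 * n = 2 * n - m + 4 * n)%N ?modnDr ?modn_small; lia.
rewrite (@modn_small (4 * n - m + 2 * n)); last by lia.
by rewrite (_ : m + 2 * n = m - 2 * n + 4 * n)%N ?modnDr ?modn_small; lia.
Qed.

Lemma prod_arc (G : F -> F) : \prod_(k | arc k) G k = \prod_(1 <= m < n) G (g ^+ m).
Proof.
rewrite -[RHS](big_map (fun m => g ^+ m) predT G) /= big_uniq //=.
rewrite map_inj_in_uniq ?iota_uniq // => i j.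
rewrite !mem_index_iota => /andP[i0 i_n] /andP[j0 j_n] /eqP; rewrite g_pow.
by rewrite !modn_small; [move/eqP | lia | lia].
Qed.

Lemma prod_lt_sum_sq_arc :
  \prod_(x | lower x) \prod_(y | lower y && (x < y)%N) skip0 (x ^+ 2 + y ^+ 2)
  = \prod_(1 <= m < n) wt (1 + g ^+ m ^+ 2).
Proof.
pose E k := arc k || arc (- k).
have EN k : E (- k) = E k by rewrite /E opprK orbC.
rewrite (@prod_lt_sum_sq E) //; first last.
- by move=> k k0 k1 k2; rewrite /E arc_inv.
- by rewrite /E -(expr0 g) opp_pow !arc_pow mod0n modn_small; move: n_gt0; lia.
rewrite -(prod_arc (fun k => wt (1 + k ^+ 2))).
pose G k := if E k then wt (1 + k ^+ 2) else 1.
transitivity (\prod_(k | lower k) G k).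
  by rewrite big_mkcondr /=; apply: eq_bigr.
transitivity (\prod_(k | arc k) G k); last first.
  by apply: eq_bigr => k ak; rewrite /G /E ak.
apply: (@half_system _ _ -%R); first exact: opprK.
- by move=> k; rewrite /G EN sqrrN.
- move=> k Gk; apply: lower_opp; apply: contra Gk => /eqP->.
  rewrite /G /E oppr0 orbb; case: ifP => // a0.
  by have := @arc_opp 0; rewrite oppr0 a0 => /(_ isT).
- move=> k; rewrite /G /E; case: ifP; rewrite ?eqxx // => ak _.
  have := @arc_opp k; have := @arc_opp (- k); rewrite opprK.
  by case/orP: ak => ->; case: (arc _) => // ? ?; try exfalso; auto.
Qed.

(** With B, B' the products of 1 + g^(2m) and 1 - g^(2m) over 0 < m < n, and C that
of g^(2m): reversing m -> n - m gives B C = (-1)^(n-1) B', because g^(2n) = -1,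
while B B' = n because g^4 is a primitive n-th root of unity.  Hence B^2 C is
n up to sign, and raising it to the power n gives chi(B) C^n = chi(g^n/2) = 1. *)
Lemma prod_arc_chi : (\prod_(1 <= m < n) (1 + g ^+ m ^+ 2)) ^+ h
  = \prod_(1 <= m < n) (-1) ^+ m.
Proof.
set B := \prod_(1 <= m < n) _; set C := \prod_(1 <= m < n) g ^+ m ^+ 2.
have n0 := n_gt0.
have gn : g ^+ n ^+ 2 = -1 by rewrite -exprM muln2 -h2n g_half.
have BC : B * C = (-1) ^+ (n.-1) * \prod_(1 <= m < n) (1 - g ^+ m ^+ 2).
  have -> : (-1) ^+ n.-1 = \prod_(1 <= m < n) (-1) :> F.
    by rewrite big_const_nat subn1; elim: n.-1 => //= i <-; rewrite exprS.
  rewrite /B big_nat_rev -!big_split /=; apply: eq_big_nat => m /andP[m0 mn].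
  rewrite mulrDl -!exprMn -exprD (_ : 1 + n - m.+1 + m = n)%N ?gn; last by lia.
  by rewrite mul1r; ring.
have BB : B * \prod_(1 <= m < n) (1 - g ^+ m ^+ 2) = n%:R.
  have zP : n.-primitive_root (g ^+ 4).
    have h4n : h.*2 = (4 * n)%N by rewrite h2n; lia.
    have n_h : (n %| h.*2)%N by rewrite h4n dvdn_mull.
    by have := dvdn_prim_root gP n_h; rewrite h4n mulnK.
  rewrite -(prim_root_prod zP) -big_split /=; apply: eq_bigr => m _.
  by rewrite [g ^+ 4 ^+ m]exprAC; ring.
have B2 : B ^+ 2 * C = (-1) ^+ n.-1 * n%:R.
  by rewrite expr2 -mulrA BC mulrCA BB.
have nn : n%:R ^+ n = 1 :> F.
  have -> : n%:R = ((2%:R * g ^+ n) / 2%:R ^+ 2) ^+ 2 :> F.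
    have four0 : 4%:R != 0 :> F by rewrite (natrM _ 2 2) mulf_neq0 ?two_neq0.
    have p4 : 4%:R * n%:R + 1 = 0 :> F.
      rewrite -natrM natr1; transitivity (p%:R : F); last exact: pchar_Fp_0.
      by congr (_ *+ _); move: p_double; rewrite h2n; lia.
    rewrite expr_div_n exprMn gn.
    have -> : n%:R = - (4%:R)^-1 * (1 - (4%:R * n%:R + 1)) :> F.
      by field.
    by rewrite p4; field; rewrite (natrM _ 4 4) mulf_neq0 four0.
  rewrite -exprM mul2n -h2n expr_div_n chi_double_i // chi_of_sq ?two_neq0 //.
  by rewrite divr1.
have Cn : C ^+ n = \prod_(1 <= m < n) (-1) ^+ m.
  rewrite /C -prodrXl; apply: eq_bigr => m _.
  by rewrite -!exprM (_ : m * 2 * n = h * m)%N ?exprM ?g_half // h2n; lia.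
have e : B ^+ h * \prod_(1 <= m < n) (-1) ^+ m = 1.
  rewrite -Cn h2n -mul2n exprM -(exprMn _ (B ^+ 2)) B2 (exprMn _ ((-1) ^+ n.-1)) nn mulr1.
  rewrite -exprM -signr_odd oddM.
  by case: (n) => //= i; rewrite andbN.
rewrite -[LHS]mulr1.
have s2 : (\prod_(1 <= m < n) (-1) ^+ m) ^+ 2 = 1 :> F.
  by rewrite -prodrXl big1 // => m _; rewrite sqrr_sign.
by rewrite -[X in _ * X]s2 expr2 mulrA e mul1r.
Qed.

End SumOfSquares.

(** The exponent n + n(n+1)/2 has the parity of the integer part of n/2. *)
Lemma sign_sum n : (-1) ^+ n * \prod_(1 <= m < n.+1) (-1) ^+ m = (-1) ^+ n./2 :> F.
Proof.
elim: n => [|n IHn]; first by rewrite big_geq // mulr1.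
rewrite big_nat_recr //= mulrCA -expr2 sqrr_sign mulr1.
transitivity ((-1) ^+ n * ((-1) ^+ n * \prod_(1 <= m < n.+1) (-1) ^+ m) : F).
  by rewrite mulrA -expr2 sqrr_sign mul1r.
rewrite IHn -exprD.
rewrite -[LHS]signr_odd -[RHS]signr_odd; congr (_ ^+ nat_of_bool _); lia.
Qed.

Lemma prod_lt_sum_sq_value n : h = n.*2 ->
  \prod_(x | lower x) \prod_(y | lower y && (x < y)%N) skip0 (x ^+ 2 + y ^+ 2)
  = (-1) ^+ n.-1./2.
Proof.
move=> h2n; have [g gP] := prim_root_ex.
have n0 := n_gt0 h2n.
rewrite (prod_lt_sum_sq_arc h2n gP) -sign_sum prednK // -(prod_arc_chi h2n gP).
have -> : (-1) ^+ n.-1 = \prod_(1 <= m < n) (-1) :> F.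
  by rewrite big_const_nat subn1; elim: n.-1 => //= i <-; rewrite exprS.
rewrite -prodrXl -big_split /=; apply: eq_big_nat => m /andP[m0 mn].
rewrite wtE; last first.
  rewrite addrC -[1]opprK subr_eq0 -(g_half h2n gP) -exprM (g_pow h2n gP) h2n.
  by rewrite !modn_small; lia.
by rewrite /eps -signr_odd /= h2n odd_double.
Qed.

(** * Back to the integers *)

(** The numerator of u/v - r is divisible by p exactly when u - r v is: p does not
divide v, nor the denominator if it divides the numerator. *)
Lemma residueF (u v : int) : v%:~R != 0 :> F ->
  residue p (u%:~R / v%:~R) = (u%:~R / v%:~R : F) :> nat.
Proof.
move=> v0; have vQ0 : v%:~R != 0 :> rat.
  by rewrite intr_eq0; apply: contra v0 => /eqP->; rewrite mulr0z.
move xE: (u%:~R / v%:~R : F) => x; rewrite /residue.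
rewrite (@eq_in_find _ _ (pred1 (x : nat))) => [|r].
  have x_size : (x < size (iota 0 p))%N by rewrite size_iota val_lt.
  by have := index_uniq 0%N x_size (iota_uniq 0 p); rewrite nth_iota ?val_lt.
rewrite mem_iota add0n => /= r_p.
pose m : int := u - r%:R * v.
have yE : u%:~R / v%:~R - r%:R = m%:~R / v%:~R :> rat.
  by rewrite /m rmorphB rmorphM /= rmorph_nat; field.
rewrite yE; set y := m%:~R / v%:~R.
have nd : numq y * v = m * denq y.
  have dn := divq_num_den y; apply: (@intr_inj rat); rewrite !rmorphM /=.
  have d0 : (denq y)%:~R != 0 :> rat by rewrite intr_eq0 denq_neq0.
  by move/(canRL (divfK d0)): dn => ->; rewrite /y mulrAC divfK // mulrC.
have -> : (p %| numq y)%Z = (p %| m)%Z.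
  apply/idP/idP => [pn|pm].
    have : (p %| m * denq y)%Z by rewrite -nd dvdz_mulr.
    rewrite mulrC Gauss_dvdzr // /coprimez.
    have /= := coprime_num_den y; rewrite -/(coprime _ _) => cop.
    have pn' : (p %| `|numq y|)%N by [].
    by rewrite -[_ == _]/(coprime _ _); exact: coprime_dvdl cop.
  have : (p %| numq y * v)%Z by rewrite nd dvdz_mulr.
  by rewrite !dvdz_Fp rmorphM /= mulf_eq0 (negbTE v0) orbF.
rewrite dvdz_Fp /m rmorphB rmorphM /= rmorph_nat subr_eq0.
rewrite -(inj_eq (divIf v0)) mulfK // xE.
apply/eqP/eqP => [e|->]; last by rewrite natr_val.
by move/(congr1 (@nat_of_ord _)): e; rewrite val_natF.
Qed.

Lemma sign_N (u v : int) : let x : F := u%:~R / v%:~R in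
  v%:~R != 0 :> F -> x != 0 -> x != 1 ->
  (-1) ^+ N p (u%:~R / v%:~R) = (2%:R * x * (1 - x)) ^+ h.
Proof.
move=> x v0 x0 x1; rewrite -gauss_less // /N -sum1_count big_mkcond expr_sum.
rewrite -/h prod_nat_lower; apply: eq_bigr => k _.
have -> : (k : nat)%:R * (u%:~R / v%:~R) = ((k : nat)%:Z * u)%:~R / v%:~R :> rat.
  by rewrite rmorphM /= mulrA.
have kx : ((k : nat)%:Z * u)%:~R / v%:~R = k * x :> F.
  by rewrite rmorphM -mulrA; congr (_ * _); exact: natr_val.
rewrite residueF // kx.
by case: ifP.
Qed.

Lemma prod_ltF n (fn : nat -> nat -> int) (G : F -> F -> F) : (n < p)%N ->
  (forall i j : nat, (fn i j)%:~R = G i%:R j%:R) ->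
  (prod_lt p n fn)%:~R = \prod_(x : F | (0 < x <= n)%N)
     \prod_(y : F | (0 < y <= n)%N && (x < y)%N) skip0 (G x y).
Proof.
move=> n_p fnG; rewrite /prod_lt rmorph_prod /= prod_nat_val //; apply: eq_bigr => x _.
rewrite rmorph_prod big_mkcond /= prod_nat_val // [RHS]big_mkcondr /=.
apply: eq_bigr => y _; rewrite dvdz_Fp fnG !natr_val /skip0.
by case: (_ < _)%N => //=; case: eqP.
Qed.

Lemma prod_sqF (fn : nat -> nat -> int) (G : F -> F -> F) :
  (forall i j : nat, (fn i j)%:~R = G i%:R j%:R) ->
  (prod_sq p h fn)%:~R = \prod_(x | lower x) \prod_(y | lower y) skip0 (G x y).
Proof.
move=> fnG; rewrite /prod_sq rmorph_prod /= prod_nat_lower; apply: eq_bigr => x _.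
rewrite rmorph_prod big_mkcond /= prod_nat_lower.
apply: eq_bigr => y _; rewrite dvdz_Fp fnG !natr_val /skip0.
by case: eqP.
Qed.

Lemma qformF (a b c : int) (i j : nat) :
  (qform a b c i j)%:~R = form a%:~R b%:~R c%:~R i%:R j%:R :> F.
Proof. by rewrite /qform /form !(rmorphD, rmorphM, rmorphXn) /=. Qed.

Lemma prod_qformF (a b c : int) :
  (prod_lt p p.-1 (qform a b c))%:~R
  = \prod_(t : F | (t != 0) && (t != 1)) wt (quad a%:~R b%:~R c%:~R t).
Proof.
rewrite (@prod_ltF _ _ (form a%:~R b%:~R c%:~R)); last exact: qformF; last first.
  by rewrite prednK // prime_gt0.
rewrite -prod_lt_ratio; apply: eq_big => x; first by rewrite val_le_pred.
by move=> _; apply: eq_bigl => y; rewrite val_le_pred.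
Qed.

(** * Evaluation of the weights *)

Lemma wt_mul2 u v : u != 0 -> v != 0 -> wt u * wt v = (u * v) ^+ h.
Proof.
move=> u0 v0; rewrite !wtE // exprMn; rewrite [LHS](_ : _ = eps ^+ 2 * (u ^+ h * v ^+ h)).
  by rewrite eps_sq mul1r.
by ring.
Qed.

(** eps chi(-1) = -1. *)
Lemma eps_chi u : eps * (- u) ^+ h = - u ^+ h.
Proof.
rewrite exprNn /eps exprS; transitivity (- ((-1) ^+ h ^+ 2 * u ^+ h)); first by ring.
by rewrite sqrr_sign mul1r.
Qed.

Lemma chi_sqM (u v : F) : u != 0 -> (u ^+ 2 * v) ^+ h = v ^+ h.
Proof. by move=> u0; rewrite exprMn chi_of_sq // mul1r. Qed.

Section Cases.
Variables a b c : F.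
Let D := b ^+ 2 - 4%:R * a * c.
Let P := \prod_(t | (t != 0) && (t != 1)) wt (quad a b c t).

(** Here 4ac = b^2, so a and c have the same character. *)
Lemma prod_wt_disc0 : a != 0 -> c != 0 -> a + b + c != 0 -> D = 0 ->
  P = (a * (a + b + c)) ^+ h.
Proof.
move=> a0 c0 s0 D0; rewrite /P prod_wt_quad01 // -/D D0 mulr0 oppr0 wt0 mul1r wt_mul2 //.
rewrite !exprMn; congr (_ * _).
have b2 : b ^+ 2 = 2%:R ^+ 2 * (a * c).
  by apply/eqP; rewrite -subr_eq0 -D0 /D; apply/eqP; ring.
have b0 : b != 0.
  by rewrite -sqrf_eq0 b2 !mulf_neq0 ?two_neq0.
have := chi_of_sq b0; rewrite b2 chi_sqM ?two_neq0 // exprMn => e.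
apply: (mulfI (_ : a ^+ h != 0)); first by rewrite expf_neq0.
by rewrite e -expr2 chi_sq.
Qed.

Lemma prod_wt_generic : a != 0 -> c != 0 -> a + b + c != 0 -> D != 0 ->
  P = - (a * c * (a + b + c) * D) ^+ h.
Proof.
move=> a0 c0 s0 D0; rewrite /P prod_wt_quad01 // -/D wt_mul2 ?oppr_eq0 ?mulf_neq0 //.
rewrite wtE // -eps_chi mulrCA -exprMn; congr (_ * _ ^+ _); ring.
Qed.

(** When 1 is a root the discriminant is (a - c)^2. *)
Lemma prod_wt_root1 : a != 0 -> c != 0 -> a + b + c = 0 -> a - c != 0 ->
  P = (- (a * c)) ^+ h.
Proof.
move=> a0 c0 s0 ac; rewrite /P prod_wt_quad01 // -/D s0 wt0 mulr1.
have -> : D = (a - c) ^+ 2.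
  rewrite /D.
  have -> : b = - (a + c) by apply/eqP; rewrite -subr_eq0 -s0; apply/eqP; ring.
  by ring.
rewrite [X in wt X](_ : _ = (a - c) ^+ 2 * - a); last by ring.
by rewrite wt_sqM // wt_mul2 ?oppr_eq0 // mulNr.
Qed.

Lemma prod_wt_double_root1 : a != 0 -> a + b + c = 0 -> a - c = 0 -> P = eps * a ^+ h.
Proof.
move=> a0 s0 /eqP; rewrite subr_eq0 => /eqP ac.
rewrite /P prod_wt_quad01 // s0 wt0 mulr1 -ac (wtE a0).
have -> : b = - (a + a) by apply/eqP; rewrite -subr_eq0 -s0 -ac; apply/eqP; ring.
by rewrite [X in wt X](_ : _ = 0) ?wt0 ?mul1r //; ring.
Qed.

End Cases.

Lemma prod_wt_monomial (a : F) : a != 0 ->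
  \prod_(t | (t != 0) && (t != 1)) wt (quad a 0 0 t) = eps * a ^+ h.
Proof.
move=> a0; rewrite prod_wt_quad01 // [X in wt X * _](_ : _ = 0); last by ring.
by rewrite !addr0 !wt0 !mul1r wtE.
Qed.

Lemma prod_wt_c0_root1 (a : F) : a != 0 ->
  \prod_(t | (t != 0) && (t != 1)) wt (quad a (- a) 0 t) = - a ^+ h.
Proof.
move=> a0; rewrite prod_wt_quad01 // [X in wt X * _](_ : _ = a ^+ 2 * - a); last by ring.
by rewrite wt_sqM // addr0 subrr !wt0 !mulr1 wtE ?oppr_eq0 // eps_chi.
Qed.

Lemma prod_wt_c0 (a b : F) : a != 0 -> b != 0 -> a + b != 0 ->
  \prod_(t | (t != 0) && (t != 1)) wt (quad a b 0 t) = (- a * (a + b)) ^+ h.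
Proof.
move=> a0 b0 s0; rewrite prod_wt_quad01 // [X in wt X * _](_ : _ = b ^+ 2 * - a); last by ring.
by rewrite wt_sqM // addr0 wt0 mulr1 wt_mul2 ?oppr_eq0.
Qed.

(** The two arguments of chi differ by the square of 2/b. *)
Lemma chi_sign_N_opp (u v : int) :
  let a : F := u%:~R in let b : F := v%:~R in a != 0 -> b != 0 -> a + b != 0 ->
  (- a * (a + b)) ^+ h = (-1) ^+ N p (- u%:~R / v%:~R) * 2%:R ^+ h.
Proof.
move=> a b a0 b0 s0; rewrite -[- u%:~R]rmorphN /= sign_N ?rmorphN //=; last first.
- rewrite -subr_eq0; apply: contra s0 => /eqP e; apply/eqP.
  transitivity (- ((- a / b - 1) * b)); first by field.
  by rewrite e mul0r oppr0.
- by rewrite mulf_neq0 ?oppr_eq0 ?invr_eq0.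
rewrite -/a -/b -exprMn -[LHS](@chi_sqM (2%:R / b)) ?mulf_neq0 ?two_neq0 ?invr_eq0 //.
by congr (_ ^+ h); field.
Qed.

(** The two arguments of chi differ by the square of 2(a - c)/c. *)
Lemma chi_sign_N_diff (u v : int) :
  let a : F := u%:~R in let c : F := v%:~R in a != 0 -> c != 0 -> a - c != 0 ->
  (- (a * c)) ^+ h = (-1) ^+ N p (u%:~R / v%:~R) * (2%:R * c * (a - c)) ^+ h.
Proof.
move=> a c a0 c0 s0; rewrite sign_N //=; last first.
- rewrite -subr_eq0; apply: contra s0 => /eqP e; apply/eqP.
  transitivity ((a / c - 1) * c); first by field.
  by rewrite e mul0r.
- by rewrite mulf_neq0 ?invr_eq0.
rewrite -/a -/c -exprMn -[LHS](@chi_sqM (2%:R * (a - c) / c))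
  ?mulf_neq0 ?two_neq0 ?invr_eq0 //.
by congr (_ ^+ h); field.
Qed.

Lemma pm_of_sq (m n : int) : (m%:~R : F) ^+ 2 = n%:~R ^+ 2 ->
  (m = n %[mod p])%Z \/ (m = - n %[mod p])%Z.
Proof.
move/eqP; rewrite eqf_sqr => /orP[]/eqP e; [left | right]; apply: eqmodz_Fp => //.
by rewrite rmorphN.
Qed.

Lemma prod_lt_sum_of_squares_mod : (p = 1 %[mod 4])%N ->
  (prod_lt p h (fun i j => i%:Z ^+ 2 + j%:Z ^+ 2)
     = (-1) ^+ ((p - 5) %/ 8)%N %[mod p])%Z.
Proof.
move=> p1; have [n pn] : exists n, p = (4 * n).+1.
  by exists (p %/ 4)%N; move: p1; have := divn_eq p 4; lia.
have h2n : h = n.*2 by rewrite /h pn; lia.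
apply: eqmodz_Fp; rewrite (@prod_ltF _ _ (fun x y => x ^+ 2 + y ^+ 2)) ?h_ltp //.
  rewrite [LHS](prod_lt_sum_sq_value h2n) rmorph_sign; congr (_ ^+ _).
  by rewrite pn; lia.
by move=> i j; rewrite rmorphD !rmorphXn.
Qed.

Lemma prod_sq_qform_mod (a b c : int) : ~~ (p %| a)%Z -> a + c = 0 ->
  let Delta := b ^+ 2 - 4 * a * c in
  let P := prod_sq p h (qform a b c) in
  (legendre p Delta = -1 \/ ((p %| Delta)%Z /\ legendre p (2 * b) = 1) ->
    (P = h`!%:Z %[mod p])%Z \/ (P = - h`!%:Z %[mod p])%Z)
  /\
  (legendre p Delta = 1 \/ ((p %| Delta)%Z /\ legendre p (2 * b) = -1) ->
    (P = 1 %[mod p])%Z \/ (P = -1 %[mod p])%Z).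
Proof.
rewrite dvdz_Fp => a0 ac Delta P.
have cE : c = - a by apply/eqP; rewrite -addr_eq0 addrC ac.
have DE : Delta%:~R = b%:~R ^+ 2 + 4%:R * a%:~R ^+ 2 :> F.
  by rewrite /Delta cE !(rmorphD, rmorphB, rmorphM, rmorphN, rmorphXn, rmorph_nat) /=; ring.
have PE : P%:~R
    = \prod_(x | lower x) \prod_(y | lower y) skip0 (form a%:~R b%:~R (- a%:~R) x y).
  by rewrite /P (prod_sqF (qformF a b c)) cE rmorphN.
have chiE (m e : int) : legendre p m = e -> m%:~R ^+ h = e%:~R :> F.
  by move=> <-; rewrite legendreF.
have bE : (2 * b)%:~R = 2%:R * b%:~R :> F by rewrite rmorphM rmorph_nat.
split=> H.
  apply: pm_of_sq; rewrite PE [RHS]fact_sq.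
  case: H => [/chiE|[]].
    by rewrite DE; apply: square_nonres.
  rewrite dvdz_Fp DE => /eqP D0 /chiE; rewrite bE => b1.
  by have [-> ->] := square_zero a0 D0; rewrite b1.
apply: pm_of_sq; rewrite PE expr1n.
case: H => [/chiE|[]].
  rewrite DE => D1; apply: square_res => //; apply/eqP => D0.
  by move/eqP: D1; rewrite D0 chi0 eq_sym oner_eq0.
rewrite dvdz_Fp DE => /eqP D0 /chiE; rewrite bE => b1.
by have [_ ->] := square_zero a0 D0; rewrite b1 opprK.
Qed.

End PrimeField.

Theorem theorem1p2 (p : nat) (p_prime : prime p) (p_odd : odd p) :
  [/\
    (* (i) *)
    (p = 1 %[mod 4])%N ->
      (prod_lt p p.-1./2 (fun i j => i%:Z ^+ 2 + j%:Z ^+ 2)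
         = (-1) ^+ ((p - 5) %/ 8)%N %[mod p])%Z,
    (* (ii) *)
    forall a b c : int, ~~ (p %| a * c * (a + b + c))%Z ->
      let Delta := b ^+ 2 - 4 * a * c in
      [/\ (p %| Delta)%Z ->
            (prod_lt p p.-1 (qform a b c)
               = legendre p (a * (a + b + c)) %[mod p])%Z,
          ~~ (p %| Delta)%Z ->
            (prod_lt p p.-1 (qform a b c)
               = - legendre p (a * c * (a + b + c) * Delta) %[mod p])%Z
        & a + c = 0 ->
          let P := prod_sq p p.-1./2 (qform a b c) in
          (legendre p Delta = -1
             \/ ((p %| Delta)%Z /\ legendre p (2 * b) = 1) ->
           (P = (p.-1./2)`!%:Z %[mod p])%Z
             \/ (P = - (p.-1./2)`!%:Z %[mod p])%Z)
          /\
          (legendre p Delta = 1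
             \/ ((p %| Delta)%Z /\ legendre p (2 * b) = -1) ->
           (P = 1 %[mod p])%Z \/ (P = -1 %[mod p])%Z)],
    (* (iii) *)
    forall a b c : int, ~~ (p %| a * c)%Z -> (p %| a + b + c)%Z ->
      (~~ (p %| a - c)%Z ->
        (prod_lt p p.-1 (qform a b c)
           = (-1) ^+ N p (a%:~R / c%:~R) * legendre p (2 * c * (a - c))
             %[mod p])%Z)
      /\
      ((p %| a - c)%Z ->
        (prod_lt p p.-1 (qform a b c)
           = (-1) ^+ p.+1./2 * legendre p a %[mod p])%Z)
    (* (iv) *)
  & forall a b c : int, (p %| a * c)%Z ->
      let P := prod_lt p p.-1 (qform a b c) in
      [/\ [/\ (p %| a)%Z -> ~~ (p %| b)%Z -> (p %| c)%Z ->
            (P = - legendre p b %[mod p])%Z,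
          (p %| a)%Z -> ~~ (p %| b * c)%Z -> (p %| b + c)%Z ->
            (P = - legendre p c %[mod p])%Z
        & (p %| a)%Z -> ~~ (p %| b * c * (b + c))%Z ->
            (P = (-1) ^+ N p (- c%:~R / b%:~R) * legendre p 2 %[mod p])%Z],
          (p %| a)%Z -> (p %| b)%Z -> ~~ (p %| c)%Z ->
            (P = (-1) ^+ p.+1./2 * legendre p c %[mod p])%Z
        & [/\ ~~ (p %| a)%Z -> (p %| b)%Z -> (p %| c)%Z ->
            (P = (-1) ^+ p.+1./2 * legendre p a %[mod p])%Z,
          ~~ (p %| a * b)%Z -> (p %| a + b)%Z -> (p %| c)%Z ->
            (P = (-1) ^+ p.+1./2 * legendre p b %[mod p])%Z
        & ~~ (p %| a * b * (a + b))%Z -> (p %| c)%Z ->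
            (P = (-1) ^+ N p (- a%:~R / b%:~R) * legendre p 2 %[mod p])%Z]]].
Proof.
have dvd := dvdz_Fp p_prime.
have char := legendreF p_prime p_odd.
have castE := (rmorphD, rmorphB, rmorphM, rmorphN, rmorphXn, rmorph_nat, rmorph_sign).
have half_succ : uphalf p = p.-1./2.+1 by move: (prime_gt0 p_prime); lia.
have natE n : (n%:R : int)%:~R = n%:R :> 'F_p by rewrite rmorph_nat.
split.
- exact: prod_lt_sum_of_squares_mod.
- move=> a b c H Delta.
  have [a0 c0 s0] : [/\ a%:~R != 0 :> 'F_p, c%:~R != 0 :> 'F_p
                      & a%:~R + b%:~R + c%:~R != 0 :> 'F_p].
    by move: H; rewrite dvd !castE /= !mulf_eq0 !negb_or => /andP[/andP[]].
  have DE : Delta%:~R = b%:~R ^+ 2 - 4%:R * a%:~R * c%:~R :> 'F_p.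
    by rewrite /Delta !castE.
  split.
  + move=> /[!dvd] /eqP D0; apply: (eqmodz_Fp p_prime).
    rewrite prod_qformF // char !castE /=.
    by rewrite prod_wt_disc0 // -DE.
  + move=> /[!dvd] D0; apply: (eqmodz_Fp p_prime).
    rewrite prod_qformF // [RHS]rmorphN /= char.
    by rewrite /Delta !castE /= prod_wt_generic // -DE.
  + by move=> ac; apply: prod_sq_qform_mod => //; rewrite dvd.
- move=> a b c; rewrite !dvd !castE /= mulf_eq0 negb_or => /andP[a0 c0] /eqP s0.
  split=> [d0|/eqP d0]; apply: (eqmodz_Fp p_prime);
    rewrite prod_qformF // [RHS]rmorphM rmorph_sign /= char.
    by rewrite !castE /= prod_wt_root1 // chi_sign_N_diff.
  by rewrite half_succ prod_wt_double_root1.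
- move=> a b c _ P.
  split; [split| |split]; rewrite !dvd ?castE /= ?(mulf_eq0, negb_or).
  + move=> /eqP a0 b0 /eqP c0; apply: (eqmodz_Fp p_prime).
    rewrite prod_qformF // [RHS]rmorphN /= char.
    by rewrite a0 c0 prod_wt_lin.
  + move=> /eqP a0 /andP[b0 c0]; rewrite addr_eq0 => /eqP bc.
    apply: (eqmodz_Fp p_prime).
    rewrite prod_qformF // [RHS]rmorphN /= char.
    by rewrite a0 bc prod_wt_quad_sym // prod_wt_c0_root1.
  + move=> /eqP a0 /andP[/andP[b0 c0]]; rewrite addrC => s0.
    apply: (eqmodz_Fp p_prime).
    rewrite prod_qformF // [RHS]rmorphM rmorph_sign /= char.
    by rewrite natE a0 prod_wt_quad_sym // prod_wt_c0 // chi_sign_N_opp.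
  + move=> /eqP a0 /eqP b0 c0; apply: (eqmodz_Fp p_prime).
    rewrite prod_qformF // [RHS]rmorphM rmorph_sign /= char.
    by rewrite a0 b0 prod_wt_quad_sym // prod_wt_monomial // half_succ.
  + move=> a0 /eqP b0 /eqP c0; apply: (eqmodz_Fp p_prime).
    rewrite prod_qformF // [RHS]rmorphM rmorph_sign /= char.
    by rewrite b0 c0 prod_wt_monomial // half_succ.
  + move=> /andP[a0 b0]; rewrite addrC addr_eq0 => /eqP ab /eqP c0.
    apply: (eqmodz_Fp p_prime).
    rewrite prod_qformF // [RHS]rmorphM rmorph_sign /= char.
    by rewrite c0 ab prod_wt_c0_root1 // half_succ eps_chi.
  + move=> /andP[/andP[a0 b0] s0] /eqP c0.
    apply: (eqmodz_Fp p_prime).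
    rewrite prod_qformF // [RHS]rmorphM rmorph_sign /= char natE.
    by rewrite c0 prod_wt_c0 // chi_sign_N_opp.
Qed.
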